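(* Let $\beta\in\mathbb{R}$ and $\psi\in B\cap\Theta_1$, and suppose that either $\Delta^2(1/\psi(k))\ge0$ for all $k\in\mathbb{N}$, or $\Delta^2(1/\psi(k))\le0$ for all $k\in\mathbb{N}$. Then there exist positive quantities $K^{(1)}_\psi$, $K^{(2)}_\psi$, depending only on $\psi$, such that for all $n\in\mathbb{N}$ $$K^{(2)}_\psi\,\psi(n)\,n\le E_n\big(C^{\psi}_{\beta,1}\big)_C\le\mathcal{E}_n\big(C^{\psi}_{\beta,1}\big)_C\le K^{(1)}_\psi\,\psi(n)\,n.$$
   Context: All functions are $2\pi$-periodic. $L_p$ ($1\le p\le\infty$) is the space of $2\pi$-periodic measurable functions with finite norm $\|f\|_p=\big(\int_0^{2\pi}|f|^p\big)^{1/p}$ for $p<\infty$ and $\|f\|_\infty=\operatorname{ess\,sup}|f|$; $C$ is the space of continuous $2\pi$-periodic functions with $\|f\|_C=\max|f|$. Let $\psi(t)>0$ be a continuous function of $t\ge1$; $\psi(k)$ denotes its values at positive integers, and $\Delta^2(1/\psi(k))=\frac1{\psi(k)}-\frac2{\psi(k+1)}+\frac1{\psi(k+2)}$. For $\beta\in\mathbb{R}$, $\Psi_\beta$ is the summable function with Fourier series $\sum_{k=1}^\infty\psi(k)\cos(kt-\beta\pi/2)$. When $\Psi_\beta\in L_\infty$, $C^{\psi}_{\beta,1}$ denotes the class of (continuous) functions $f(x)=\frac{a_0}{2}+\frac1\pi\int_{-\pi}^{\pi}\Psi_\beta(x-t)\varphi(t)\,dt$ with $a_0\in\mathbb{R}$,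 $\int_{-\pi}^{\pi}\varphi=0$, $\|\varphi\|_1\le1$. $\mathcal{T}_{2n-1}$ is the space of trigonometric polynomials of degree at most $n-1$, $S_{n-1}(f)$ is the Fourier partial sum of order $n-1$, $\mathcal{E}_n(C^{\psi}_{\beta,1})_C=\sup_{f\in C^{\psi}_{\beta,1}}\|f-S_{n-1}(f)\|_C$, $E_n(C^{\psi}_{\beta,1})_C=\sup_{f\in C^{\psi}_{\beta,1}}\inf_{t\in\mathcal{T}_{2n-1}}\|f-t\|_C$. $B$ is the set of positive nonincreasing functions $\psi$ on $[1,\infty)$ with $\psi(t)/\psi(2t)\le K$ for some constant $K$ and all $t\ge1$. $\Theta_1$ is the set of nonincreasing functions $\psi$ on $[1,\infty)$ for which there exists $\alpha>1$ and $K>0$ with $t_1^\alpha\psi(t_1)\le K t_2^\alpha\psi(t_2)$ for all $t_1>t_2\ge1$. *)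

(* Defs.v *)
From HB Require Import structures.
From mathcomp Require Import all_boot all_order all_algebra.
From mathcomp Require Import all_classical all_reals all_analysis.
Set Implicit Arguments.
Unset Strict Implicit.
Unset Printing Implicit Defensive.
Import Order.TTheory GRing.Theory Num.Theory.
Import numFieldNormedType.Exports.
Local Open Scope classical_set_scope.
Local Open Scope ring_scope.

Section Defs.
Variable R : realType.
Notation mu := (@lebesgue_measure R).

Definition periodic2pi (g : R -> R) : Prop := forall x, g (x + 2 * pi) = g x.

Definition nonincr1 (psi : R -> R) : Prop :=
  forall t1 t2 : R, 1 <= t1 -> t1 <= t2 -> psi t2 <= psi t1.

Definition classB (psi : R -> R) : Prop :=
  (forall t, 1 <= t -> 0 < psi t) /\ nonincr1 psi /\
  exists K : R, forall t, 1 <= t -> psi t / psi (2 * t) <= K.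

Definition classTheta1 (psi : R -> R) : Prop :=
  nonincr1 psi /\
  exists alpha K : R, 1 < alpha /\ 0 < K /\
    forall t1 t2 : R, 1 <= t2 -> t2 < t1 ->
      t1 `^ alpha * psi t1 <= K * (t2 `^ alpha * psi t2).

Definition Delta2inv (psi : R -> R) (k : nat) : R :=
  (psi k%:R)^-1 - 2 * (psi k.+1%:R)^-1 + (psi k.+2%:R)^-1.

(* Psi_beta(t) = sum_{k>=1} psi(k) cos(k t - beta pi / 2)
   (absolutely and uniformly convergent for psi in Theta_1) *)
Definition Psi_beta (psi : R -> R) (beta : R) (t : R) : R :=
  limn (fun N : nat => \sum_(1 <= k < N) (psi k%:R * cos (k%:R * t - beta * pi / 2))).

Definition admissible_phi (phi : R -> R) : Prop :=
  periodic2pi phi /\ measurable_fun setT phi /\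
  mu.-integrable `[0, 2 * pi] (EFin \o phi) /\
  (\int[mu]_(t in `[(- pi)%R, pi%R]) (phi t)%:E = 0)%E /\
  (\int[mu]_(t in `[0%R, (2 * pi)%R]) `|phi t|%:E <= 1)%E.

Definition Cpsi_beta1 (psi : R -> R) (beta : R) : set (R -> R) :=
  [set f | exists (a0 : R) (phi : R -> R), admissible_phi phi /\
     forall x, f x = a0 / 2 +
       pi^-1 * Rintegral mu `[- pi, pi] (fun t => Psi_beta psi beta (x - t) * phi t)].

Definition fcoef_a (f : R -> R) (k : nat) : R :=
  pi^-1 * Rintegral mu `[- pi, pi] (fun t => f t * cos (k%:R * t)).
Definition fcoef_b (f : R -> R) (k : nat) : R :=
  pi^-1 * Rintegral mu `[- pi, pi] (fun t => f t * sin (k%:R * t)).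

Definition fourier_partial (m : nat) (f : R -> R) (x : R) : R :=
  fcoef_a f 0 / 2 +
  \sum_(1 <= k < m.+1) (fcoef_a f k * cos (k%:R * x) + fcoef_b f k * sin (k%:R * x)).

Definition trigpoly (n : nat) : set (R -> R) :=
  [set T | exists a b : nat -> R, forall x,
     T x = a 0 / 2 + \sum_(1 <= k < n) (a k * cos (k%:R * x) + b k * sin (k%:R * x))].

Definition supnorm (g : R -> R) : \bar R :=
  ereal_sup [set `|g x|%:E | x in [set: R]].

Definition calE (n : nat) (C : set (R -> R)) : \bar R :=
  ereal_sup [set supnorm (fun x => f x - fourier_partial n.-1 f x) | f in C].

Definition bestE (n : nat) (C : set (R -> R)) : \bar R :=
  ereal_sup [set ereal_inf [set supnorm (fun x => f x - T x) | T in trigpoly n]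
            | f in C].
End Defs.

(* Main.v *)
(* Upper bound: the deviation f - S_{n-1} f is the tail of the expansion of f, which is
   dominated termwise by the sum of psi(k) over k >= n, and psi(k) <= K (n/k)^alpha psi(n)
   with alpha > 1 makes that sum O(n psi(n)).
   Lower bound: let F be the Fejer kernel of order m = 3n, let N = 4n and w = beta pi / 2.
   Take phi proportional to F(t) cos(N t), normalised in L_1, and test the resulting f
   against h(x) = F(x) cos(N x - w).  All frequencies of phi and h lie strictly between
   n and 7n, so h is orthogonal to every polynomial of degree < n and
   int f h = int (f - T) h <= |f - T|_C int F.  The left-hand side is at least
   psi(7n) n^2 up to a constant, because about n^3 pairs of terms of phi and h resonate,
   and psi(7n) is comparable to psi(n) since psi is in B. *)
Require Import Defs.
From HB Require Import structures.
From mathcomp Require Import all_boot all_order all_algebra.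
From mathcomp Require Import all_classical all_reals all_analysis.
From mathcomp Require Import measurable_realfun.
From mathcomp Require Import ring lra zify.
Import Order.TTheory GRing.Theory Num.Theory.
Import numFieldNormedType.Exports.
Local Open Scope classical_set_scope.
Local Open Scope ring_scope.

(** * Integration over one period: orthogonality of shifted cosines and change of period *)

Section Circle.
Context {R : realType}.
Notation mu := (@lebesgue_measure R).
Notation D := `[(- pi : R)%R, pi]%classic.
Notation I f := (Rintegral mu D f).
Notation intg f := (mu.-integrable D (EFin \o f)).
Implicit Types (f g phi : R -> R) (k l n m : nat) (a b x t : R).

Lemma measurable_D : measurable (D : set (measurableTypeR R)).
Proof. exact: measurable_itv. Qed.
#[local] Hint Resolve measurable_D : core.

Lemma ltNpipi : - pi < pi :> R.
Proof. have := pi_gt0 R; lra. Qed.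

Lemma Rintegral_D_cst a : I (fun=> a) = 2 * pi * a.
Proof.
rewrite Rintegral_cst// [X in fine X](_ : _ = (2 * pi)%:E) /=; first by rewrite mulrC.
rewrite [LHS]lebesgue_measure_itv /= lte_fin ltNpipi; congr (_%:E); lra.
Qed.

Lemma integrable_continuous f : continuous f -> intg f.
Proof.
move=> cf; apply: continuous_compact_integrable; first exact: segment_compact.
exact: continuous_subspaceT.
Qed.

Lemma integrable_bigsum (T : Type) (s : seq T) (P : pred T) (F : T -> R -> R) :
  (forall i, intg (F i)) -> intg (fun x => \sum_(i <- s | P i) F i x).
Proof.
move=> iF.
rewrite (_ : _ \o _ = fun x => (\sum_(i <- s | P i) (EFin \o F i) x)%E); last first.
  by apply/funext => x /=; rewrite sumEFin.
exact: integrable_sum.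
Qed.

Lemma Rintegral_sum (T : Type) (s : seq T) (P : pred T) (F : T -> R -> R) :
  (forall i, intg (F i)) ->
  I (fun x => \sum_(i <- s | P i) F i x) = \sum_(i <- s | P i) I (F i).
Proof.
move=> iF; elim: s => [|i s IH].
  rewrite big_nil -[RHS](_ : I (cst 0) = 0); first by apply: eq_Rintegral => x _; rewrite big_nil.
  by rewrite Rintegral_cst// mul0r.
rewrite big_cons (_ : (fun _ => _) = fun x => if P i then F i x + \sum_(j <- s | P j) F j x
    else \sum_(j <- s | P j) F j x); last by apply/funext => x; rewrite big_cons.
case: (P i) => //; rewrite RintegralD ?IH//; exact: integrable_bigsum.
Qed.

Lemma Rintegral_dominated_cvg (u : nat -> R -> R) f g :
  (forall n, intg (u n)) -> intg g ->
  (forall n x, D x -> `|u n x| <= g x) ->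
  (forall x, D x -> u n x @[n --> \oo] --> f x) ->
  intg f /\ I (u n) @[n --> \oo] --> I f.
Proof.
move=> iu ig ug uf.
have mu_ n := measurable_int mu (iu n).
have uf' x : D x -> (EFin \o u n) x @[n --> \oo] --> (EFin \o f) x.
  by move=> Dx; apply: cvg_EFin; [exact: nearW|exact: uf].
have mf := emeasurable_fun_cvg _ _ mu_ uf'.
have [] := @dominated_convergence _ _ _ mu D measurable_D (fun n => EFin \o u n)
  (EFin \o f) (EFin \o g) mu_ mf _ ig _.
- by apply: aeW => x Dx; exact: uf'.
- by apply: aeW => x n Dx; rewrite /= lee_fin ug.
move=> intf _ cv; split => //.
apply/fine_cvg; rewrite fineK//.
exact: integrable_fin_num.
Qed.

Lemma continuous_cos_affine a b : continuous (fun t => cos (a * t + b)).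
Proof.
move=> t; apply: continuous_comp; last exact: continuous_cos.
by apply: cvgD; [apply: cvgM; [exact: cvg_cst|exact: cvg_id]|exact: cvg_cst].
Qed.

Lemma integrable_cos a b : intg (fun t => cos (a * t + b)).
Proof. exact: integrable_continuous (continuous_cos_affine a b). Qed.

Lemma sin_natpi k : sin (k%:R * pi) = 0 :> R.
Proof.
elim: k => [|k IH]; first by rewrite mul0r sin0.
by rewrite -addn1 natrD mulrDl mul1r sinDpi IH oppr0.
Qed.

(** The primitive sin(a t + b) / a changes by 2 cos(b) sin(a pi) / a across the interval. *)
Lemma Rintegral_cos_eq0 a b : a != 0 -> sin (a * pi) = 0 ->
  I (fun t => cos (a * t + b)) = 0.
Proof.
move=> a0 sa.
pose F t := a^-1 * sin (a * t + b).
have dF t : is_derive t (1:R) F (cos (a * t + b)).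
  apply: is_derive_eq; rewrite /GRing.scale /=.
  by field.
rewrite /Rintegral (@continuous_FTC2 _ _ F)//.
- by rewrite /F /= mulrN !sinD sinN cosN sa oppr0 !mul0r subrr.
- exact: ltNpipi.
- exact: continuous_subspaceT (continuous_cos_affine a b).
- have cF : continuous F.
    by move=> t; apply/differentiable_continuous/derivable1_diffP; case: (dF t).
  split => [t _||]; first by case: (dF t).
  + exact/cvg_at_right_filter/cF.
  + exact/cvg_at_left_filter/cF.
- by move=> t _; rewrite derive1E; case: (dF t).
Qed.

Lemma Rintegral_cosB k l b :
  I (fun t => cos ((k%:R - l%:R) * t + b)) = if k == l then 2 * pi * cos b else 0.
Proof.
case: eqVneq => [->|kl].
  rewrite subrr; under eq_Rintegral do rewrite mul0r add0r.
  by rewrite Rintegral_D_cst.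
rewrite Rintegral_cos_eq0//; first by rewrite subr_eq0 eqr_nat.
by rewrite mulrBl sinB !sin_natpi mul0r mulr0 subrr.
Qed.

(** Product-to-sum. The condition on k + l excludes k = l = 0, where the sum frequency would not
    integrate to zero. *)
Lemma Rintegral_coscos k l a b : (0 < k + l)%N ->
  I (fun t => cos (k%:R * t + a) * cos (l%:R * t + b)) =
  if k == l then pi * cos (a - b) else 0.
Proof.
move=> kl0.
have -> : I (fun t => cos (k%:R * t + a) * cos (l%:R * t + b)) =
  I (fun t => 2^-1 * (cos ((k + l)%:R * t + (a + b)) + cos ((k%:R - l%:R) * t + (a - b)))).
  apply: eq_Rintegral => t _.
  rewrite (_ : (k + l)%:R * t + (a + b) = (k%:R * t + a) + (l%:R * t + b)); last first.
    by rewrite natrD; ring.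
  rewrite (_ : (k%:R - l%:R) * t + (a - b) = (k%:R * t + a) - (l%:R * t + b)); last by ring.
  by move: (_ * t + a) (_ * t + b) => X Y; rewrite cosD cosB; lra.
have i1 := integrable_cos (k + l)%:R (a + b).
have i2 := integrable_cos (k%:R - l%:R) (a - b).
rewrite RintegralZl//; last first.
  rewrite (_ : _ \o _ = (EFin \o (fun t => cos ((k + l)%:R * t + (a + b)))) \+
    (EFin \o (fun t => cos ((k%:R - l%:R) * t + (a - b)))))%E//.
  exact: integrableD.
rewrite RintegralD// Rintegral_cos_eq0 ?add0r; last 2 first.
- by rewrite pnatr_eq0 -lt0n.
- exact: sin_natpi.
rewrite Rintegral_cosB; case: eqP => _; last by rewrite mulr0.
by field.
Qed.

(** Lebesgue measure equals its pushforward under a translation, since both agree on half-open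
    intervals. *)
Lemma ge0_integral_shift (c : R) (A : set R) g : measurable A ->
  measurable_fun setT g -> (forall x, 0 <= g x) ->
  (\int[mu]_(x in A) (g x)%:E = \int[mu]_(x in [set x | A (x + c)%R]) (g (x + c)%R)%:E)%E.
Proof.
move=> mA mg g0.
pose phi := (fun x => x + c) : measurableTypeR R -> measurableTypeR R.
have mphi : measurable_fun setT phi by exact: measurable_funD.
pose nu' : {measure set (measurableTypeR R) -> \bar R} := pushforward mu phi.
pose nu := nu' mphi.
have munu (X : set (measurableTypeR R)) : measurable X -> lebesgue_measure X = nu X.
  apply: lebesgue_measure_unique => _ [[u v] _ <-]; rewrite /nu /= /pushforward.
  rewrite (_ : phi @^-1` _ = `]u - c, v - c]%classic); last first.
    by apply/seteqP; split => x; rewrite /phi /= !in_itv/= ltrBlDr lerBrDr.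
  rewrite !lebesgue_measure_itv/= !lte_fin ltrD2r; case: ifP => // _.
  by congr (_%:E); rewrite opprB addrA subrK.
rewrite (@eq_measure_integral _ _ _ _ nu); last by move=> X mX _; exact: munu.
rewrite ge0_integral_pushforward//.
  by apply/measurable_EFinP; exact: measurable_funS mg.
by move=> x _; rewrite lee_fin.
Qed.

(** [admissible_phi] measures the norm over [0, 2 pi], whereas the convolution runs over [- pi, pi].
    Both intervals contain [0, pi], and the remaining pieces differ by a shift of one period. *)
Lemma ge0_integral_period g : (forall x, g (x + 2 * pi) = g x) ->
  measurable_fun setT g -> (forall x, 0 <= g x) ->
  (\int[mu]_(x in `[0%R, (2 * pi)%R]) (g x)%:E = \int[mu]_(x in D) (g x)%:E)%E.
Proof.
move=> pg mg g0.
have pi0 := pi_gt0 R.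
have mE (A : set (measurableTypeR R)) : measurable A -> measurable_fun A (EFin \o g).
  by move=> mA; apply/measurable_EFinP; exact: measurable_funS mg.
have cutE (u v w : R) : u <= v -> v <= w ->
  (\int[mu]_(x in `[u, w]) (g x)%:E =
   \int[mu]_(x in `[u, v]) (g x)%:E + \int[mu]_(x in `]v, w]) (g x)%:E)%E.
  move=> uv vw.
  rewrite (@itv_bndbnd_setU _ _ _ (BRight v)) ?bnd_simp// ge0_integral_setU//.
  - by apply mE; exact: measurableU.
  - by move=> x _; rewrite lee_fin.
  - rewrite disj_set2E; apply/eqP/seteqP; split => // x [] /=; rewrite !in_itv/=.
    by move=> /andP[_ ?] /andP[]; lra.
have -> := cutE 0 pi (2 * pi); [|lra..].
have -> := cutE (- pi) 0 pi; [|lra..].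
rewrite addeC; congr (_ + _)%E; last first.
  by rewrite integral_itv_obnd_cbnd//; exact: mE.
rewrite (@ge0_integral_shift (2 * pi))//.
rewrite (_ : [set _ | _] = `](- pi), 0]%classic); last first.
  by apply/seteqP; split => x /=; rewrite !in_itv/= => /andP[] ? ?; apply/andP; split; lra.
under eq_integral do rewrite pg.
by rewrite integral_itv_obnd_cbnd//; exact: mE.
Qed.

End Circle.

(** * Tail sums of [psi] and convergence of numerical series *)

Section Series.
Context {R : realType}.
Implicit Types (psi : R -> R) (c d : nat -> R).

(** With q = k + 1 and k = q (1 - 1/q), this is q ^ (1 - alpha) times the Bernoulli-type bound (1 -
    1/q) ^ (1 - alpha) >= 1 + (alpha - 1) / q. It replaces the comparison of a sum of powers with an
    integral. *)
Lemma powR_telescope (alpha : R) (k : nat) : 1 < alpha -> (0 < k)%N ->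
  (alpha - 1) * k.+1%:R `^ (- alpha) <= k%:R `^ (1 - alpha) - k.+1%:R `^ (1 - alpha).
Proof.
move=> a1 k0.
set q : R := k.+1%:R; set p : R := k%:R.
have p0 : 0 < p by rewrite ltr0n.
have q0 : 0 < q by rewrite ltr0n.
have qp : p = q * (1 + - q^-1).
  by rewrite mulrDr mulr1 mulrN divff ?gt_eqF// /q /p -natr1 addrK.
clearbody p q; have r0 : 0 < 1 + - q^-1 by rewrite -(pmulr_rgt0 _ q0) -qp.
have ln_le : ln (1 + - q^-1) <= - q^-1 by apply: le_ln1Dx; lra.
have pw : 1 + (alpha - 1) / q <= (1 + - q^-1) `^ (1 - alpha).
  rewrite /powR gt_eqF//; apply: le_trans (expR_ge1Dx _).
  rewrite lerD2l; nra.
rewrite {1}qp powRM ?(ltW q0) ?(ltW r0)//.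
have -> : q `^ (- alpha) = q `^ (1 - alpha) / q.
  rewrite [X in q `^ X = _](_ : _ = (1 - alpha) - 1); last by lra.
  by rewrite [LHS]powRB ?(gt_eqF q0) ?implybT// powRr1// ltW.
have := powR_ge0 q (1 - alpha).
set P := q `^ _; set X := _ `^ (1 - alpha) in pw *; move=> P0.
rewrite -subr_ge0 (_ : _ - _ = P * (X - (1 + (alpha - 1) / q))); last by ring.
by rewrite mulr_ge0// subr_ge0.
Qed.

Lemma classTheta1_tail psi : (forall t, 1 <= t -> 0 < psi t) -> classTheta1 psi ->
  exists2 S : R, 0 < S & forall n m, (0 < n)%N ->
    \sum_(n <= k < m) psi k%:R <= S * (psi n%:R * n%:R).
Proof.
move=> psi0 [_ [alpha [K [a1 [K0 HK]]]]].
have am1 : 0 < alpha - 1 by lra.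
have Kdiv := divr_gt0 K0 am1.
(* The 1 pays for the term k = n, the fraction for all later terms. *)
exists (1 + K / (alpha - 1)); first by lra.
move=> n m n0.
have pn : 0 < psi n%:R by apply: psi0; rewrite ler1n.
have n1 : 1 <= n%:R :> R by rewrite ler1n.
have [mn|nm] := leqP m n.
  by rewrite big_geq// mulr_ge0 ?mulr_ge0 ?(ltW pn)//; lra.
(* Theta_1 gives psi(k) <= K n ^ alpha psi(n) k ^ (- alpha) for k > n; the division by alpha - 1
   prepares the telescoping. *)
pose C : R := K * (n%:R `^ alpha * psi n%:R) / (alpha - 1).
have C0 : 0 <= C by rewrite divr_ge0 ?(ltW am1)// mulr_ge0 ?(ltW K0)// mulr_ge0 ?powR_ge0 ?(ltW pn).
have tele j : \sum_(n.+1 <= k < n.+1 + j) psi k%:R <=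
    C * (n%:R `^ (1 - alpha) - (n + j)%:R `^ (1 - alpha)).
  elim: j => [|j IH]; first by rewrite addn0 big_geq// addn0 subrr mulr0.
  rewrite addnS big_nat_recr/=; last by lia.
  have h : psi (n.+1 + j)%:R <= C * ((n + j)%:R `^ (1 - alpha) - (n + j).+1%:R `^ (1 - alpha)).
    have q0 : 0 < (n + j).+1%:R :> R by rewrite ltr0n.
    have qa := powR_gt0 alpha q0.
    apply: (@le_trans _ _ (C * ((alpha - 1) * (n + j).+1%:R `^ (- alpha)))); last first.
      by rewrite ler_wpM2l// powR_telescope//; lia.
    rewrite /C mulrA divfK ?gt_eqF// powRN ler_pdivlMr// mulrC addSn HK// ltr_nat; lia.
  rewrite addnS; apply: le_trans (lerD IH h) _.
  by rewrite -mulrDr addrA subrK.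
have := tele (m - n.+1)%N; rewrite subnKC// => h.
rewrite big_ltn//.
have Cn : C * n%:R `^ (1 - alpha) = K / (alpha - 1) * (psi n%:R * n%:R).
  have : n%:R `^ alpha * n%:R `^ (1 - alpha) = n%:R :> R.
    rewrite -powRD; last by rewrite pnatr_eq0 -lt0n n0 implybT.
    by rewrite addrC subrK powRr1.
  rewrite /C; move: (_ `^ alpha) (_ `^ (1 - _)) => u v <-.
  by field; rewrite gt_eqF.
have := mulr_ge0 C0 (powR_ge0 ((n + (m - n.+1))%:R) (1 - alpha)).
rewrite mulrBr Cn in h => Cm.
have := ler_pM (ltW pn) ler01 (lexx (psi n%:R)) n1.
by move: h Cm; lra.
Qed.

Lemma cvg_partial_sum c d (M : R) :
  (forall k, (0 < k)%N -> `|c k| <= d k) -> (forall n, \sum_(1 <= k < n) d k <= M) ->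
  cvgn (fun n => \sum_(1 <= k < n) c k).
Proof.
move=> cd dM.
(* Absolute convergence is stated for series starting at 0, while the bound on [c] starts at 1:
   hence the change of starting index here and its reversal below. *)
rewrite (is_cvg_series_restrict 1 c); apply: normed_cvg.
rewrite -(is_cvg_series_restrict 1 (fun k => `|c k|)).
apply: nondecreasing_is_cvgn.
  apply/nondecreasing_seqP => -[|n] /=; first by rewrite !big_geq.
  by rewrite [leRHS]big_nat_recr//= lerDl.
exists M => _ [n _ <-]; apply: le_trans (dM n).
by apply: ler_sum_nat => k /andP[k0 _]; exact: cd.
Qed.

Lemma sum_nat_pick c (l n : nat) :
  \sum_(1 <= k < n) (if k == l then c k else 0) = if (0 < l < n)%N then c l else 0.
Proof.
case: ifP => [/andP[l0 lN]|ln].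
  rewrite (big_cat_nat (n := l)) ?(ltnW lN)//= (@big_ltn _ _ _ l)// eqxx.
  rewrite !big1_seq ?add0r ?addr0// => k; rewrite mem_index_iota => /andP[_ /andP[kl lk]].
    by rewrite gtn_eqF.
  by rewrite ltn_eqF.
by rewrite big1_seq// => k; rewrite mem_index_iota; case: eqP => // -> /=; rewrite ln.
Qed.

End Series.

(** * Fourier expansion of functions in [Cpsi_beta1], and the upper bound *)

Section BestApproximation.
Set Implicit Arguments.
Unset Strict Implicit.
Context {R : realType}.
Notation mu := (@lebesgue_measure R).
Notation D := `[(- pi : R)%R, pi]%classic.
Notation I f := (Rintegral mu D f).
Notation intg f := (mu.-integrable D (EFin \o f)).
Implicit Types (f g phi psi : R -> R) (A B : nat -> R) (k l n m N : nat) (a b x t : R).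
#[local] Hint Resolve measurable_D : core.

Lemma integrable_mul_bounded f phi (M : R) : continuous f ->
  (forall x, `|f x| <= M) -> intg phi -> intg (fun x => f x * phi x).
Proof.
move=> cf fM iphi.
apply: (integrableMr measurable_D (h := f) _ _ iphi).
  exact: measurable_funTS (continuous_measurable_fun cf).
exists M; split; first exact: num_real.
by move=> y /ltW My x _ /=; apply: le_trans (fM x) My.
Qed.

Lemma integrable_cos_mul phi a b : intg phi -> intg (fun t => cos (a * t + b) * phi t).
Proof.
apply: integrable_mul_bounded; first exact: continuous_cos_affine.
by move=> x; exact: cos_max.
Qed.

Lemma admissible_phi_integrable phi : admissible_phi phi ->
  intg phi /\ I (fun t => `|phi t|) <= 1.
Proof.
move=> [pphi [mphi [_ [_ le1]]]].
have mabs : measurable_fun setT (fun t => `|phi t|) by exact: measurableT_comp.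
rewrite (ge0_integral_period (fun t => `|phi t|)) in le1 => //; last first.
  by move=> x; rewrite pphi.
split; last first.
  rewrite -lee_fin /Rintegral fineK//.
  rewrite ge0_fin_numE ?(le_lt_trans le1) ?ltry//.
  by apply: integral_ge0 => x _; rewrite lee_fin.
apply/integrableP; split; first by apply/measurable_EFinP; exact: measurable_funS mphi.
by apply: le_lt_trans le1 _; exact: ltry.
Qed.

Lemma normr_Rintegral_cos_mul phi a b : intg phi ->
  I (fun t => `|phi t|) <= 1 -> `|I (fun t => cos (a * t + b) * phi t)| <= 1.
Proof.
move=> iphi phi1; have ic := integrable_cos_mul a b iphi.
apply: le_trans phi1; apply: le_trans (le_normr_Rintegral _ ic) _ => //.
apply: le_Rintegral => //.
- exact: (integrable_norm ic).
- exact: (integrable_norm iphi).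
- move=> x _; rewrite normrM ler_piMl//; exact: cos_max.
Qed.

(** [Psi_beta] is a [limn], meaningful only where the limit exists; domination by the summable [psi]
    provides this. *)
Lemma Psi_beta_cvg psi beta t (M : R) : (forall k, (0 < k)%N -> 0 <= psi k%:R) ->
  (forall N, \sum_(1 <= k < N) psi k%:R <= M) ->
  \sum_(1 <= k < N) psi k%:R * cos (k%:R * t - beta * pi / 2) @[N --> \oo]
    --> Psi_beta psi beta t.
Proof.
move=> psi0 psiM; apply: (cvg_partial_sum _ (fun k => psi k%:R) M) => // k k0.
by rewrite normrM ger0_norm ?psi0// ler_piMr ?psi0// cos_max.
Qed.

(** Termwise integration by dominated convergence, with majorant M |phi|. Evenness of cos turns k (x
    - t) - w into k t + (w - k x), where w = beta pi / 2. *)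
Lemma Psi_beta_conv_cvg psi beta phi x (M : R) : (forall k, (0 < k)%N -> 0 <= psi k%:R) ->
  (forall N, \sum_(1 <= k < N) psi k%:R <= M) -> intg phi ->
  \sum_(1 <= k < N) psi k%:R *
     I (fun t => cos (k%:R * t + (beta * pi / 2 - k%:R * x)) * phi t) @[N --> \oo]
    --> I (fun t => Psi_beta psi beta (x - t) * phi t).
Proof.
move=> psi0 psiM iphi.
pose v k t := psi k%:R * (cos (k%:R * t + (beta * pi / 2 - k%:R * x)) * phi t).
have iv k : intg (v k).
  exact: (integrableZl _ _ (integrable_cos_mul _ _ iphi)).
pose u N t := \sum_(1 <= k < N) v k t.
have M0 : 0 <= M by have := psiM 0%N; rewrite big_geq.
have [||||_] := Rintegral_dominated_cvg u
  (fun t => Psi_beta psi beta (x - t) * phi t) (fun t => M * `|phi t|).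
- by move=> N; exact: (integrable_bigsum _ _ _ v).
- exact: (integrableZl _ _ (integrable_norm iphi)).
- move=> N t _; apply: le_trans (ler_norm_sum _ _ _) _.
  apply: (@le_trans _ _ (\sum_(1 <= k < N) psi k%:R * `|phi t|)); last first.
    by rewrite -mulr_suml ler_wpM2r.
  apply: ler_sum_nat => k /andP[k0 _]; rewrite /v !normrM ger0_norm ?psi0//.
  by rewrite ler_wpM2l ?psi0// ler_piMl// cos_max.
- move=> t _.
  rewrite (_ : (fun N => u N t) = fun N => (\sum_(1 <= k < N) psi k%:R *
      cos (k%:R * (x - t) - beta * pi / 2)) * phi t).
    by apply: cvgM; [exact: Psi_beta_cvg psi0 psiM|exact: cvg_cst].
  apply/funext => N; rewrite mulr_suml; apply: eq_bigr => k _.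
  rewrite /v mulrA; congr (_ * _ * _); rewrite -cosN; congr cos; ring.
move=> cv; rewrite [X in X @ _](_ : _ = fun N => I (u N))//.
apply/funext => N; rewrite (Rintegral_sum _ _ _ v)//; apply: eq_bigr => k _.
by rewrite RintegralZl//; exact: integrable_cos_mul.
Qed.

(** The constant term is a separate argument, so that it need not be tied to [A 0]. The bound N is
    exclusive: the degree is below N. *)
Definition trig_poly (a0 : R) A B N x : R :=
  a0 / 2 + \sum_(1 <= k < N) (A k * cos (k%:R * x) + B k * sin (k%:R * x)).

Lemma Cpsi_beta1_expansion psi beta f (M : R) : (forall k, (0 < k)%N -> 0 <= psi k%:R) ->
  (forall N, \sum_(1 <= k < N) psi k%:R <= M) -> Cpsi_beta1 psi beta f ->
  exists a0 A B,
    (forall k x, (0 < k)%N -> `|A k * cos (k%:R * x) + B k * sin (k%:R * x)| <= psi k%:R) /\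
    forall x, trig_poly a0 A B N x @[N --> \oo] --> f x.
Proof.
move=> psi0 psiM [a0 [phi [/admissible_phi_integrable[iphi phi1] fE]]].
set w := beta * pi / 2 in fE *.
(* Expanding cos((k t + w) - k x) leaves the cosine and the sine of k t + w as weights; in [B] the
   sine is written as a cosine shifted by pi / 2. *)
pose A k := psi k%:R / pi * I (fun t => cos (k%:R * t + w) * phi t).
pose B k := psi k%:R / pi * I (fun t => cos (k%:R * t + (w - pi / 2)) * phi t).
have AB k x : A k * cos (k%:R * x) + B k * sin (k%:R * x) =
    pi^-1 * (psi k%:R * I (fun t => cos (k%:R * t + (w - k%:R * x)) * phi t)).
  rewrite /A /B -!(mulrA (_ / pi)) -mulrDr mulrA [in RHS](mulrC pi^-1); congr (_ * _).
  rewrite -!RintegralZr//; try exact: integrable_cos_mul.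
  rewrite -RintegralD//; try exact: (integrableZr _ _ (integrable_cos_mul _ _ iphi)).
  apply: eq_Rintegral => t _.
  by rewrite !addrA cosBpihalf cosB; ring.
exists a0, A, B; split => [k x k0|x].
  rewrite AB !normrM (ger0_norm (psi0 _ k0)) ger0_norm ?invr_ge0 ?pi_ge0//.
  have := normr_Rintegral_cos_mul k%:R (w - k%:R * x) iphi phi1.
  (* The integral is at most 1 in modulus, and the factor 1 / pi is simply bounded by 1. *)
  move=> /(ler_wpM2l (psi0 _ k0)); rewrite mulr1; apply: le_trans => /=.
  rewrite ler_piMl ?mulr_ge0 ?psi0// invf_le1 ?pi_gt0//; have := pi_ge2 R; lra.
rewrite fE; apply: cvgD; first exact: cvg_cst.
rewrite [X in X @ _](_ : _ = fun N => pi^-1 * \sum_(1 <= k < N) psi k%:R *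
     I (fun t => cos (k%:R * t + (w - k%:R * x)) * phi t)).
  by apply: cvgM; [exact: cvg_cst|exact: Psi_beta_conv_cvg psi0 psiM iphi].
by apply/funext => N; rewrite mulr_sumr; apply: eq_bigr => k _; rewrite AB.
Qed.

Lemma continuous_trig_poly a0 A B N : continuous (trig_poly a0 A B N).
Proof.
move=> x; apply: cvgD; first exact: cvg_cst.
move: x; apply: continuous_big => [|k _ x]; first exact: add_continuous.
apply: cvgD; (apply: cvgM; first exact: cvg_cst).
  have := continuous_cos_affine k%:R 0 x.
  by under eq_fun do rewrite addr0.
have := continuous_cos_affine k%:R (- (pi / 2)) x.
by under eq_fun do rewrite cosBpihalf.
Qed.

(** The free phase b handles both kinds of coefficient at once: b = 0 extracts [A l] and b = - pi /
    2 extracts [B l]. *)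
Lemma Rintegral_trig_poly_cos a0 A B N l b :
  I (fun x => trig_poly a0 A B N x * cos (l%:R * x + b)) =
  if l == 0%N then pi * a0 * cos b
  else if (l < N)%N then pi * (A l * cos b - B l * sin b) else 0.
Proof.
pose c k e x := cos (k%:R * x + e) * cos (l%:R * x + b).
have ic k e : intg (c k e).
  apply: integrable_continuous => x.
  by apply: cvgM; exact: continuous_cos_affine.
pose v k x := A k * c k 0 x + B k * c k (- (pi / 2)) x.
have iZ (r : R) k e : intg (fun x => r * c k e x) by exact: (integrableZl _ _ (ic k e)).
have iv k : intg (v k) by exact: (integrableD _ (iZ _ _ _) (iZ _ _ _)).
have -> : I (fun x => trig_poly a0 A B N x * cos (l%:R * x + b)) =
    I (fun x => a0 / 2 * c 0%N 0 x + \sum_(1 <= k < N) v k x).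
  apply: eq_Rintegral => x _; rewrite /trig_poly mulrDl /c mul0r add0r cos0 mul1r.
  congr (_ + _); rewrite mulr_suml; apply: eq_bigr => k _.
  by rewrite /v /c cosBpihalf addr0; ring.
rewrite RintegralD//; last exact: integrable_bigsum.
rewrite (Rintegral_sum _ _ _ v)// RintegralZl//.
have Iv k : (0 < k)%N -> I (v k) = if k == l then pi * (A l * cos b - B l * sin b) else 0.
  move=> k0; rewrite RintegralD// !RintegralZl// !Rintegral_coscos ?addn_gt0 ?k0//.
  case: eqP => [->|_]; last by ring.
  by rewrite sub0r cosN -opprD cosN (addrC (pi / 2)) cosDpihalf; ring.
have -> : \sum_(1 <= k < N) I (v k) =
    \sum_(1 <= k < N) if k == l then pi * (A l * cos b - B l * sin b) else 0.
  by apply: eq_big_nat => k /andP[k0 _]; exact: Iv.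
rewrite (sum_nat_pick (fun=> pi * (A l * cos b - B l * sin b))).
have [l0|l0] := eqVneq l 0%N.
  rewrite l0 addr0 (_ : I (c 0%N 0) = I (fun=> cos b)); first by rewrite Rintegral_D_cst; field.
  by apply: eq_Rintegral => x _; rewrite /c l0 !mul0r !add0r cos0 mul1r.
rewrite Rintegral_coscos; last by rewrite add0n lt0n.
by rewrite eq_sym (negbTE l0) mulr0 add0r lt0n l0.
Qed.

(** The truncations are bounded by |a0 / 2| + M, so dominated convergence applies, and their
    coefficient at l no longer changes once N > l. *)
Lemma trig_poly_limit_coef f a0 A B psi (M : R) l b :
  (forall k x, (0 < k)%N -> `|A k * cos (k%:R * x) + B k * sin (k%:R * x)| <= psi k%:R) ->
  (forall N, \sum_(1 <= k < N) psi k%:R <= M) ->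
  (forall x, trig_poly a0 A B N x @[N --> \oo] --> f x) ->
  I (fun x => f x * cos (l%:R * x + b)) =
  if l == 0%N then pi * a0 * cos b else pi * (A l * cos b - B l * sin b).
Proof.
move=> ABpsi psiM fE.
have [||||_] := Rintegral_dominated_cvg
  (fun N x => trig_poly a0 A B N x * cos (l%:R * x + b))
  (fun x => f x * cos (l%:R * x + b)) (fun=> `|a0 / 2| + M).
- move=> N; apply: integrable_continuous => x; apply: cvgM.
    exact: continuous_trig_poly.
  exact: continuous_cos_affine.
- by apply: integrable_continuous => x; exact: cvg_cst.
- move=> N x _; rewrite normrM -[leRHS]mulr1 ler_pM// ?cos_max//.
  apply: le_trans (ler_normD _ _) _; rewrite lerD2l.
  apply: le_trans (ler_norm_sum _ _ _) _; apply: le_trans (psiM N).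
  by apply: ler_sum_nat => k /andP[k0 _]; exact: ABpsi.
- by move=> x _; apply: cvgM; [exact: fE|exact: cvg_cst].
move=> /cvg_lim <-//.
apply: cvg_lim => //; apply: cvg_near_cst; exists l.+1 => // N /= lN.
by rewrite Rintegral_trig_poly_cos lN.
Qed.

Lemma fourier_partial_trig_poly f a0 A B psi (M : R) n :
  (forall k x, (0 < k)%N -> `|A k * cos (k%:R * x) + B k * sin (k%:R * x)| <= psi k%:R) ->
  (forall N, \sum_(1 <= k < N) psi k%:R <= M) ->
  (forall x, trig_poly a0 A B N x @[N --> \oo] --> f x) ->
  fourier_partial n f = trig_poly a0 A B n.+1.
Proof.
move=> ABpsi psiM fE; have coef l b := trig_poly_limit_coef l b ABpsi psiM fE.
have pi0 : pi != 0 :> R by rewrite gt_eqF// pi_gt0.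
have aE l : fcoef_a f l = if l == 0%N then a0 else A l.
  have := coef l 0; rewrite cos0 sin0 mulr0 subr0 !mulr1.
  under eq_Rintegral do rewrite addr0.
  by rewrite /fcoef_a => ->; case: ifP => _; rewrite mulKf.
have bE l : (0 < l)%N -> fcoef_b f l = B l.
  move=> l0; have := coef l (- (pi / 2)).
  rewrite gtn_eqF// cosN sinN cos_pihalf sin_pihalf.
  under eq_Rintegral do rewrite cosBpihalf.
  by rewrite /fcoef_b => ->; rewrite mulKf//; ring.
apply/funext => x; rewrite /fourier_partial /trig_poly aE; congr (_ + _).
by apply: eq_big_nat => k /andP[k0 _]; rewrite aE bE// gtn_eqF.
Qed.

(** The partial sum of f is its truncated expansion, so the error is a limit of blocks of terms from
    n to N, each bounded by the tail of [psi]. *)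
Lemma calE_le psi beta (S : R) n : (0 < n)%N -> (forall k, (0 < k)%N -> 0 <= psi k%:R) ->
  (forall n m, (0 < n)%N -> \sum_(n <= k < m) psi k%:R <= S * (psi n%:R * n%:R)) ->
  (calE n (Cpsi_beta1 psi beta) <= (S * psi n%:R * n%:R)%:E)%E.
Proof.
(* The tail estimate at n = 1 bounds every partial sum. *)
move=> n0 psi0 tail; pose M := S * (psi 1 * 1).
have psiM N : \sum_(1 <= k < N) psi k%:R <= M by exact: tail.
apply: ge_ereal_sup => _ [f + <-] => /(Cpsi_beta1_expansion psi0 psiM).
move=> [a0 [A [B [ABpsi fE]]]].
apply: ge_ereal_sup => _ [x _ <-].
rewrite (fourier_partial_trig_poly _ ABpsi psiM fE) prednK// lee_fin -mulrA.
have cv : `|trig_poly a0 A B N x - trig_poly a0 A B n x| @[N --> \oo] -->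
    `|f x - trig_poly a0 A B n x|.
  by apply: cvg_norm; apply: cvgB; [exact: fE|exact: cvg_cst].
apply: (cvgr_to_le cv); exists n => // N /= nN.
apply: le_trans (tail n N n0).
rewrite /trig_poly (big_cat_nat (n := n) (p := N))//= addrA [X in `|X|]addrC addKr.
apply: le_trans (ler_norm_sum _ _ _) _; apply: ler_sum_nat => k /andP[nk _].
by apply: ABpsi; exact: leq_trans nk.
Qed.

Lemma bestE_le_calE n (C : set (R -> R)) : (0 < n)%N -> (bestE n C <= calE n C)%E.
Proof.
move=> n0; apply: ge_ereal_sup => _ [f Cf <-].
apply: le_trans (ereal_sup_ubound _); last by exists f.
apply: ereal_inf_lbound; exists (fourier_partial n.-1 f) => //.
by exists (fcoef_a f), (fcoef_b f) => x; rewrite /fourier_partial prednK.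
Qed.

(** * The Fejer kernel *)

Definition fejer m t : R :=
  (\sum_(j < m) cos (j%:R * t)) ^+ 2 + (\sum_(j < m) sin (j%:R * t)) ^+ 2.

Lemma fejer_ge0 m t : 0 <= fejer m t.
Proof. by rewrite addr_ge0 ?sqr_ge0. Qed.

(** [fejer m t] is the squared modulus of the sum of e^(i j t) over j < m, that is, m times the
    usual kernel. Expanding the square over index pairs and multiplying by e^(i (a t + b)), the real
    part gives the identity. *)
Lemma fejer_cos m a b t :
  \sum_(u : 'I_m * 'I_m) cos ((a + u.1%:R - u.2%:R) * t + b) = fejer m t * cos (a * t + b).
Proof.
rewrite -(pair_bigA _ (fun i j : 'I_m => cos ((a + i%:R - j%:R) * t + b))) /=.
rewrite /fejer; set C := \sum_(j < m) cos _; set S := \sum_(j < m) sin _.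
have [w wE] : {w | w = a * t + b} by exists (a * t + b).
rewrite -wE.
transitivity (\sum_(i < m) (cos (i%:R * t) * (C * cos w + S * sin w) +
    sin (i%:R * t) * (S * cos w - C * sin w))).
  apply: eq_bigr => i _.
  transitivity (\sum_(j < m) (cos (j%:R * t) * (cos (i%:R * t) * cos w - sin (i%:R * t) * sin w) +
      sin (j%:R * t) * (cos (i%:R * t) * sin w + sin (i%:R * t) * cos w))).
    apply: eq_bigr => j _.
    rewrite (_ : _ + b = w + i%:R * t - j%:R * t); last by rewrite wE; ring.
    by rewrite cosB cosD sinD; ring.
  by rewrite big_split/= -!mulr_suml -/C -/S; ring.
by rewrite big_split/= -!mulr_suml -/C -/S; ring.
Qed.

Lemma fejer_sum m t : fejer m t = \sum_(u : 'I_m * 'I_m) cos ((u.1%:R - u.2%:R) * t + 0).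
Proof.
have := fejer_cos m 0 0 t; rewrite mul0r addr0 cos0 mulr1 => <-.
by apply: eq_bigr => u _; rewrite add0r.
Qed.

Lemma integrable_fejer m : intg (fejer m).
Proof.
rewrite (_ : fejer m = fun t => \sum_(u : 'I_m * 'I_m) cos ((u.1%:R - u.2%:R) * t + 0)).
  by apply: integrable_bigsum => u; exact: integrable_cos.
by apply/funext => t; exact: fejer_sum.
Qed.

(** Only the m diagonal index pairs have zero frequency. *)
Lemma Rintegral_fejer m : I (fejer m) = 2 * pi * m%:R.
Proof.
rewrite (_ : fejer m = fun t => \sum_(u : 'I_m * 'I_m) cos ((u.1%:R - u.2%:R) * t + 0)).
  rewrite Rintegral_sum; last by move=> u; exact: integrable_cos.
  rewrite (eq_bigr (fun u : 'I_m * 'I_m => if u.1 == u.2 then 2 * pi else 0)); last first.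
    by move=> u _; rewrite Rintegral_cosB cos0 mulr1.
  rewrite -(pair_bigA _ (fun i j : 'I_m => if i == j then 2 * pi else 0)) /=.
  rewrite (eq_bigr (fun=> 2 * pi)); first by rewrite sumr_const card_ord mulr_natr.
  move=> i _; rewrite -big_mkcond/= (eq_bigl (pred1 i)) ?big_pred1_eq//.
by apply/funext => t; exact: fejer_sum.
Qed.

(** * The Fejer kernel shifted to frequencies around N, and its convolution with [Psi_beta] *)

Section Modulated.
Variables (m N : nat).
Hypotheses (m0 : (0 < m)%N) (mN : (m <= N)%N).

(** The subtraction is the truncated one on naturals; [mN] makes it exact. *)
Definition freq (u : 'I_m * 'I_m) : nat := (N + u.1 - u.2)%N.

Lemma freq_bounds u : (N - m < freq u < N + m)%N.
Proof. by case: u => i j; rewrite /freq /=; have := ltn_ord i; have := ltn_ord j; lia. Qed.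

Lemma freq_gt0 u : (0 < freq u)%N.
Proof. by have := freq_bounds u; lia. Qed.

Lemma sum_cos_freq b t :
  \sum_u cos ((freq u)%:R * t + b) = fejer m t * cos (N%:R * t + b).
Proof.
rewrite -fejer_cos; apply: eq_bigr => -[i j] _; rewrite /freq /= natrB ?natrD//.
by have := ltn_ord j; lia.
Qed.

Lemma normr_sum_cos_freq b t : `|\sum_u cos ((freq u)%:R * t + b)| <= fejer m t.
Proof.
by rewrite sum_cos_freq normrM ger0_norm ?fejer_ge0// ler_piMr ?fejer_ge0// cos_max.
Qed.

(** The prefactor is the inverse of the integral of [fejer m]. The product with cos(N t) is kept as
    a sum of cosines, ready for orthogonality. *)
Definition modulated_fejer t : R :=
  (2 * pi * m%:R)^-1 * \sum_u cos ((freq u)%:R * t + 0).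

Let c_gt0 : 0 < (2 * pi * m%:R)^-1 :> R.
Proof. by rewrite invr_gt0 !mulr_gt0 ?pi_gt0 ?ltr0n. Qed.

Lemma continuous_modulated_fejer : continuous modulated_fejer.
Proof.
move=> t; apply: cvgM; first exact: cvg_cst.
move: t; apply: continuous_big => [|u _]; first exact: add_continuous.
exact: continuous_cos_affine.
Qed.

(** Integer frequencies give the period, their positivity gives mean zero, and domination by the
    normalised kernel gives norm at most 1. *)
Lemma admissible_modulated_fejer : admissible_phi modulated_fejer.
Proof.
have iphi := integrable_continuous _ continuous_modulated_fejer.
have pphi : periodic2pi modulated_fejer.
  move=> x; congr (_ * _); apply: eq_bigr => u _.
  rewrite !addr0 mulrDr (_ : _ * (2 * pi) = (pi *+ 2) *+ freq u).
    by rewrite (periodicn (@cosD2pi R)).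
  by rewrite -[RHS]mulr_natl -[pi *+ 2]mulr_natl.
have mphi := continuous_measurable_fun continuous_modulated_fejer.
split => //; split => //; split; last split.
- apply: continuous_compact_integrable; first exact: segment_compact.
  exact: continuous_subspaceT continuous_modulated_fejer.
- rewrite -[LHS]fineK ?integrable_fin_num//; congr (_%:E).
  rewrite [LHS]RintegralZl//; last by apply: integrable_bigsum => u; exact: integrable_cos.
  rewrite Rintegral_sum; last by move=> u; exact: integrable_cos.
  rewrite big1 ?mulr0// => u _; apply: Rintegral_cos_eq0 (sin_natpi _).
  by rewrite pnatr_eq0 -lt0n freq_gt0.
- rewrite (ge0_integral_period (fun t => `|modulated_fejer t|)) //; last 2 first.
    by move=> x; rewrite pphi.
    exact: measurableT_comp.
  have inorm := integrable_norm iphi.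
  rewrite -[leLHS]fineK ?integrable_fin_num// lee_fin.
  apply: (@le_trans _ _ (I (fun t => (2 * pi * m%:R)^-1 * fejer m t))).
    apply: le_Rintegral => //; first exact: (integrableZl _ _ (integrable_fejer m)).
    by move=> x _; rewrite normrM (gtr0_norm c_gt0) ler_pM2l// normr_sum_cos_freq.
  rewrite RintegralZl//; last exact: integrable_fejer.
  by rewrite Rintegral_fejer mulVf// gt_eqF// -invr_gt0.
Qed.

Lemma conv_modulated_fejer psi beta x (M : R) : (forall k, (0 < k)%N -> 0 <= psi k%:R) ->
  (forall N, \sum_(1 <= k < N) psi k%:R <= M) ->
  pi^-1 * I (fun t => Psi_beta psi beta (x - t) * modulated_fejer t) =
  (2 * pi * m%:R)^-1 *
    \sum_u psi (freq u)%:R * cos ((freq u)%:R * x - beta * pi / 2).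
Proof.
move=> psi0 psiM.
have iphi := integrable_continuous _ continuous_modulated_fejer.
have /cvg_lim <- // := Psi_beta_conv_cvg (beta := beta) (x := x) psi0 psiM iphi.
set w := beta * pi / 2.
have Ik k e : I (fun t => cos (k%:R * t + e) * modulated_fejer t) =
    (2 * pi * m%:R)^-1 * \sum_u if k == freq u then pi * cos e else 0.
  pose v (u : 'I_m * 'I_m) t := cos (k%:R * t + e) * cos ((freq u)%:R * t + 0).
  have iv u : intg (v u).
    by apply: integrable_continuous => t; apply: cvgM; exact: continuous_cos_affine.
  transitivity (I (fun t => (2 * pi * m%:R)^-1 * \sum_u v u t)).
    apply: eq_Rintegral => t _; rewrite /modulated_fejer mulrCA; congr (_ * _).
    by rewrite mulr_sumr.
  rewrite RintegralZl//; last exact: integrable_bigsum.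
  rewrite (Rintegral_sum _ _ _ v)//; congr (_ * _); apply: eq_bigr => u _.
  by rewrite Rintegral_coscos ?subr0// addn_gt0 freq_gt0 orbT.
have pi0 : pi != 0 :> R by rewrite gt_eqF// pi_gt0.
rewrite -[RHS](mulKf pi0); congr (_ * _).
(* All frequencies lie below N + m, so the partial sums are constant from there on. *)
apply: cvg_lim => //; apply: cvg_near_cst; exists (N + m)%N => // N' /= leN'.
under eq_bigr do rewrite Ik mulrCA mulr_sumr.
rewrite -mulr_sumr mulrCA; congr (_ * _).
rewrite exchange_big/= mulr_sumr; apply: eq_bigr => u _.
under eq_bigr do rewrite (fun_if (fun y => psi _ * y)) mulr0.
rewrite (sum_nat_pick (fun k => psi k%:R * (pi * cos (w - k%:R * x)))).
have /andP[_ uN] := freq_bounds u.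
rewrite freq_gt0 (leq_trans uN leN') /= mulrCA; congr (_ * (_ * _)).
by rewrite -cosN opprB.
Qed.

End Modulated.

(* (a, b, c) gives the index pairs (n + a, n + c) and (n + b, n + b + c - a), which
   have equal differences. *)
Lemma card_freq_eq n N : (3 * n <= N)%N ->
  (n ^ 3 <= #|[pred w : ('I_(3 * n) * 'I_(3 * n)) * ('I_(3 * n) * 'I_(3 * n)) |
      freq N w.1 == freq N w.2]|)%N.
Proof.
move=> nN.
have H1 (a : 'I_n) : (n + a < 3 * n)%N by have := ltn_ord a; lia.
have H2 (a b c : 'I_n) : (n + b + c - a < 3 * n)%N.
  by have := ltn_ord a; have := ltn_ord b; have := ltn_ord c; lia.
pose g (x : 'I_n * 'I_n * 'I_n) : ('I_(3 * n) * 'I_(3 * n)) * ('I_(3 * n) * 'I_(3 * n)) :=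
  ((Ordinal (H1 x.1.1), Ordinal (H1 x.2)), (Ordinal (H1 x.1.2), Ordinal (H2 x.1.1 x.1.2 x.2))).
have ginj : injective g.
  move=> [[a b] c] [[a' b'] c'] [/addnI aa' /addnI cc' /addnI bb' _].
  by congr (_, _, _); exact: val_inj.
rewrite (_ : (n ^ 3)%N = #|{: 'I_n * 'I_n * 'I_n}|); last first.
  by rewrite !card_prod !card_ord !expnS expn0 muln1 mulnA.
rewrite -(card_codom ginj); apply/subset_leq_card/fintype.subsetP => _ /codomP[[[a b] c] ->].
rewrite inE /g /freq /=; have := ltn_ord a; have := ltn_ord b; have := ltn_ord c; lia.
Qed.

(** * Lower bound for the best approximation by duality *)

Lemma supnorm_lt g (L : R) : (supnorm g < L%:E)%E -> forall x, `|g x| <= L.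
Proof.
move=> gL x; rewrite -lee_fin; apply: le_trans (ltW gL).
by apply: ereal_sup_ubound; exists x.
Qed.

(** Every [freq] exceeds N - m >= n, hence lies outside the spectrum of T. *)
Lemma Rintegral_trigpoly_freq n m N b T : trigpoly n T -> (n + m <= N)%N -> (0 < m)%N ->
  continuous T /\ I (fun x => T x * \sum_(u : 'I_m * 'I_m) cos ((freq N u)%:R * x + b)) = 0.
Proof.
move=> [A [B TE]] nmN m0.
have -> : T = trig_poly (A 0%N) A B n by exact/funext.
split; first exact: continuous_trig_poly.
pose v (u : 'I_m * 'I_m) x := trig_poly (A 0%N) A B n x * cos ((freq N u)%:R * x + b).
have iv u : intg (v u).
  apply: integrable_continuous => x; apply: cvgM; first exact: continuous_trig_poly.
  exact: continuous_cos_affine.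
transitivity (I (fun x => \sum_u v u x)).
  by apply: eq_Rintegral => x _; rewrite mulr_sumr.
rewrite (Rintegral_sum _ _ _ v)// big1// => u _.
have mN : (m <= N)%N by lia.
have := freq_bounds m0 mN u => /andP[lo _].
rewrite Rintegral_trig_poly_cos gtn_eqF ?(leq_trans _ lo)//.
by rewrite ltnNge (_ : (n <= _)%N)//; lia.
Qed.

Lemma bestE_ge psi beta (M p : R) n : (0 < n)%N ->
  (forall k, (0 < k)%N -> 0 <= psi k%:R) ->
  (forall N, \sum_(1 <= k < N) psi k%:R <= M) -> 0 < p ->
  (forall k, (0 < k < 7 * n)%N -> p <= psi k%:R) ->
  ((p * n%:R / (72 * pi))%:E <= bestE n (Cpsi_beta1 psi beta))%E.
Proof.
move=> n0 psi0 psiM p0 ppsi.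
have pi0 := pi_gt0 R.
pose m := (3 * n)%N; pose N := (4 * n)%N.
have m0 : (0 < m)%N by rewrite /m; lia.
have mN : (m <= N)%N by rewrite /m /N; lia.
pose k (u : 'I_m * 'I_m) := freq N u.
pose phi : R -> R := modulated_fejer m N.
pose w := beta * pi / 2.
pose f x := 0 / 2 + pi^-1 * I (fun t => Psi_beta psi beta (x - t) * phi t).
have Cf : Cpsi_beta1 psi beta f.
  by exists 0, phi; split=> //; exact: admissible_modulated_fejer.
pose c : R := (2 * pi * m%:R)^-1.
have c0 : 0 < c by rewrite invr_gt0 !mulr_gt0// ltr0n.
have fE x : f x = \sum_u c * psi (k u)%:R * cos ((k u)%:R * x + - w).
  rewrite /f mul0r add0r (conv_modulated_fejer m0 mN _ _ psi0 psiM) mulr_sumr.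
  by apply: eq_bigr => u _; rewrite mulrA.
pose h x := \sum_u cos ((k u)%:R * x + - w).
have ch : continuous h.
  apply: continuous_big => [|u _]; first exact: add_continuous.
  exact: continuous_cos_affine.
have cf : continuous f.
  rewrite (_ : f = fun x => \sum_u c * psi (k u)%:R * cos ((k u)%:R * x + - w)); last exact/funext.
  apply: continuous_big => [|u _ x]; first exact: add_continuous.
  by apply: cvgM; [exact: cvg_cst|exact: continuous_cos_affine].
(* Non-resonant pairs integrate to 0. A resonant pair gives c psi(k) pi >= c pi p, the phases
   cancelling because f and h both carry - w; [card_freq_eq] counts at least n^3 such pairs. *)
have fh : c * pi * p * n%:R ^+ 3 <= I (fun x => f x * h x).
  pose v (z : ('I_m * 'I_m) * ('I_m * 'I_m)) x := c * psi (k z.1)%:R *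
    (cos ((k z.1)%:R * x + - w) * cos ((k z.2)%:R * x + - w)).
  have icc z : intg (fun x => cos ((k z.1)%:R * x + - w) * cos ((k z.2)%:R * x + - w)).
    by apply: integrable_continuous => x; apply: cvgM; exact: continuous_cos_affine.
  have iv z : intg (v z) by exact: (integrableZl _ _ (icc z)).
  have -> : I (fun x => f x * h x) = I (fun x => \sum_z v z x).
    apply: eq_Rintegral => x _; rewrite fE /h mulr_suml.
    rewrite -(pair_bigA _ (fun u u' => v (u, u') x)) /=; apply: eq_bigr => u _.
    by rewrite mulr_sumr; apply: eq_bigr => u' _; rewrite /v mulrA.
  rewrite (Rintegral_sum _ _ _ v)//.
  apply: (@le_trans _ _ (\sum_(z | k z.1 == k z.2) c * pi * p)).
    rewrite sumr_const -[leRHS]mulr_natr ler_pM2l ?mulr_gt0// -natrX ler_nat.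
    by rewrite card_freq_eq.
  rewrite big_mkcond/=; apply: ler_sum => z _.
  rewrite RintegralZl// Rintegral_coscos; last by rewrite addn_gt0 (freq_gt0 m0 mN).
  case: eqP => _; last by rewrite mulr0.
  rewrite subrr cos0 mulr1 mulrAC ler_pM2r// ler_pM2l// ppsi//.
  rewrite (freq_gt0 m0 mN); have /andP[_] := freq_bounds m0 mN z.1.
  by rewrite /k; move: (freq _ _) => q; rewrite /N /m; lia.
apply: le_trans (ereal_sup_ubound _); last by exists f.
apply: le_ereal_inf_tmp => _ [T Tn <-].
(* Suppose some T approximates f better than the claimed bound L; the integral of f h then becomes
   too small. *)
rewrite leNgt; apply/negP => /supnorm_lt gL.
set L := p * n%:R / (72 * pi) in gL.
have [cT Th] : continuous T /\ I (fun x => T x * h x) = 0.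
  by apply: (Rintegral_trigpoly_freq _ Tn) => //; rewrite /N /m; lia.
have := fh; apply/negP; rewrite -ltNge.
have -> : I (fun x => f x * h x) = I (fun x => (f x - T x) * h x).
  rewrite -[LHS]subr0 -Th -RintegralB//.
  - by apply: eq_Rintegral => x _; rewrite mulrBl.
  - by apply: integrable_continuous => x; apply: cvgM; [exact: cf|exact: ch].
  - by apply: integrable_continuous => x; apply: cvgM; [exact: cT|exact: ch].
have L0 : 0 < L by rewrite /L !mulr_gt0 ?invr_gt0 ?mulr_gt0// ltr0n.
(* Here |f - T| <= L, |h| <= F, and F has integral 2 pi m. *)
apply: (@le_lt_trans _ _ (L * (2 * pi * m%:R))).
  rewrite -Rintegral_fejer -RintegralZl//; last exact: integrable_fejer.
  apply: le_Rintegral => //.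
  - apply: integrable_continuous => x; apply: cvgM; last exact: ch.
    by apply: cvgB; [exact: cf|exact: cT].
  - exact: (integrableZl _ _ (integrable_fejer m)).
  - move=> x _; apply: le_trans (ler_norm _) _; rewrite normrM; apply: ler_pM => //.
    exact: (normr_sum_cos_freq m0 mN).
have nR : 0 < n%:R :> R by rewrite ltr0n.
(* With m = 3 n the two sides are p n^2 / 6 and p n^2 / 12; the constant 72, twice the critical 36,
   makes the inequality strict. *)
rewrite /L /c /m natrM -subr_gt0.
move: (pi : R) pi0 (n%:R) nR => q q0 r r0.
rewrite (_ : _ - _ = p * r ^+ 2 / 12); first by rewrite !mulr_gt0 ?exprn_gt0 ?invr_gt0.
by field; rewrite (gt_eqF q0) (gt_eqF r0).
Qed.

End BestApproximation.

(** * Assembly of the constants from the tail bound and the doubling constant *)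

Theorem theorem2 (R : realType) (psi : R -> R) :
  {within `[1, +oo[, continuous psi} ->
  classB psi -> classTheta1 psi ->
  ((forall k : nat, (0 < k)%N -> 0 <= Delta2inv psi k) \/
   (forall k : nat, (0 < k)%N -> Delta2inv psi k <= 0)) ->
  exists K1 K2 : R, 0 < K1 /\ 0 < K2 /\
    forall (beta : R) (n : nat), (0 < n)%N ->
      ((K2 * psi n%:R * n%:R)%:E <= bestE n (Cpsi_beta1 psi beta))%E /\
      (bestE n (Cpsi_beta1 psi beta) <= calE n (Cpsi_beta1 psi beta))%E /\
      (calE n (Cpsi_beta1 psi beta) <= (K1 * psi n%:R * n%:R)%:E)%E.
Proof.
move=> _ [psi_gt0 [psi_ni [K HK]]] Th _.
have [S S0 tail] := classTheta1_tail psi psi_gt0 Th.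
have psiN k : (0 < k)%N -> 0 < psi k%:R by move=> k0; apply: psi_gt0; rewrite ler1n.
have psiN' k : (0 < k)%N -> 0 <= psi k%:R by move=> /psiN/ltW.
have K0 : 0 < K.
  by apply: lt_le_trans (HK 1 (lexx 1)); rewrite divr_gt0 ?psi_gt0// mulr1 ler1n.
have half t : 1 <= t -> psi t <= K * psi (2 * t).
  by move=> t1; rewrite -ler_pdivrMr ?HK//; apply: psi_gt0; lra.
have pi0 := pi_gt0 R.
(* The factor 72 pi comes from [bestE_ge], and K^3 from three doublings of the argument. *)
exists S, (72 * pi * K ^+ 3)^-1; split => //; split.
  by rewrite invr_gt0 !mulr_gt0 ?exprn_gt0.
move=> beta n n0; split; last by split; [exact: bestE_le_calE|exact: calE_le].
have n1 : 1 <= n%:R :> R by rewrite ler1n.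
pose p := psi n%:R / K ^+ 3.
have p0 : 0 < p by rewrite divr_gt0 ?exprn_gt0// psiN.
have := @bestE_ge R psi beta (S * (psi 1 * 1)) p n n0 psiN' (fun N => tail 1%N N isT) p0 _.
rewrite /p (_ : (72 * pi * K ^+ 3)^-1 * _ * _ = psi n%:R / K ^+ 3 * n%:R / (72 * pi)); last first.
  by move: (pi : R) pi0 => q q0; field; rewrite !gt_eqF.
apply => k /andP[k0 k7].
(* Since k < 7 n <= 8 n, monotonicity reduces the claim to comparing psi(8 n) with psi(n). *)
have kn : k%:R <= 2 * (2 * (2 * n%:R)) :> R by rewrite -!natrM ler_nat; lia.
apply: le_trans (psi_ni _ _ _ kn); last by rewrite ler1n.
rewrite ler_pdivrMr ?exprn_gt0//.
have h1 := half _ n1.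
have h2 : psi (2 * n%:R) <= K * psi (2 * (2 * n%:R)) by apply: half; lra.
have h3 : psi (2 * (2 * n%:R)) <= K * psi (2 * (2 * (2 * n%:R))) by apply: half; lra.
apply: le_trans h1 _; rewrite [leRHS]mulrC !exprS expr0 mulr1 -!mulrA ler_pM2l//.
by apply: le_trans h2 _; rewrite ler_pM2l.
Qed.
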